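(* Let $H$ and $K$ be two almost normal subgroups of a group $G$. Assume there exists $g\in G$ such that $gKg^{-1}$ is strongly commensurable with $H$. If there is a length function $L$ on $G$ such that $gKg^{-1}\cup H\subseteq N_L$, then the Hecke pair $(G,H)$ has (RD) with respect to $L$ if and only if the Hecke pair $(G,K)$ has (RD) with respect to $L$.
   Context: All groups are discrete. Two subgroups $H,K$ of a group $G$ are strongly commensurable if $H\cap K$ has finite index in both $H$ and $K$. A subgroup $H\leq G$ is almost normal if every double coset $HgH$ ($g\in G$) is a union of finitely many left cosets of $H$; then $(G,H)$ is called a Hecke pair. A length function on $G$ is a map $L:G\to[0,\infty)$ with $L(1)=0$, $L(g^{-1})=L(g)$ and $L(gh)\leq L(g)+L(h)$ for all $g,h\in G$; put $N_L=\{g\in G: L(g)=0\}$. A length function on a Hecke pair $(G,H)$ is a length function $L$ on $G$ with $H\subseteq N_L$ (so $L$ is constant on double cosets of $H$). $\mathcal{H}(G,H)$ is the space of finitely supported complex functions on the set of double cosets $G//H$, regarded as $H$-bi-invariant functions on $G$; elements of $\ell^2(H\backslash G)$ are regarded as left $H$-invariant functions on $G$. The regular representation $\lambda:\mathcal{H}(G,H)\to\mathcal{B}(\ell^2(H\backslash G))$ is $\lambda(f)(\xi)(g)=\sum_{h\in H\backslash G} f(gh^{-1})\xi(h)$ (sum over representatives of right cosets). For $s\geq 0$, $\|f\|_{s,L}=\big(\sum_{g\in H\backslash G}|f(g)|^2(1+L(g))^{2s}\big)^{1/2}$ (sum over representatives of right cosets). For a length function $L$ on a Hecke pair $(G,H)$,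 the pair $(G,H)$ has property (RD) with respect to $L$ if there are positive real numbers $C,s$ with $\|\lambda(f)\|\leq C\|f\|_{s,L}$ for all $f\in\mathcal{H}(G,H)$. *)

(* Defs.v *)
From HB Require Import structures.
From mathcomp Require Import all_boot all_order all_algebra.
From mathcomp Require Import all_classical all_reals all_analysis.
From mathcomp Require Import complex.

Set Implicit Arguments.
Unset Strict Implicit.
Unset Printing Implicit Defensive.

Import Order.TTheory GRing.Theory Num.Theory.
Import Normc.

Local Open Scope classical_set_scope.

Section Subgroups.
Local Open Scope group_scope.
Variable G : groupType.
Implicit Types (H K : set G) (g x : G).

Definition subgroup H : Prop := group_closed (mem H).

Definition lcoset H x : set G := [set x * h | h in H].
Definition rcoset H x : set G := [set h * x | h in H].
Definition dcoset H x : set G := [set h * x * k | h in H & k in H].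

(* g K g^-1; this is [K :^ g^-1] in the convention x ^ y = y^-1 * x * y
   of the library. *)
Definition conjugate g K : set G := [set g * k * g^-1 | k in K].

Definition finite_index_in H0 H : Prop :=
  H0 `<=` H /\ finite_set [set lcoset H0 h | h in H].

Definition strongly_commensurable H K : Prop :=
  finite_index_in (H `&` K) H /\ finite_index_in (H `&` K) K.

Definition almost_normal H : Prop :=
  subgroup H /\
  forall g, exists2 A : set G,
    finite_set A & dcoset H g = \bigcup_(a in A) lcoset H a.

(* T is a system of representatives of the right cosets H x, that is,
   of H \ G. *)
Definition right_transversal H (T : set G) : Prop :=
  forall x, exists! t, T t /\ rcoset H x t.

End Subgroups.

Section RapidDecay.
Variables (R : realType) (G : groupType).
Local Open Scope group_scope.
Local Open Scope ring_scope.
Local Open Scope complex_scope.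
Implicit Types (H T : set G) (L : G -> R) (f xi : G -> R[i]) (s : R).

Definition length_function L : Prop :=
  [/\ forall g, 0 <= L g,
      L 1%g = 0,
      forall g, L g^-1%g = L g &
      forall g h, L (g * h)%g <= L g + L h].

Definition zero_set L : set G := [set g | L g = 0].

Definition hecke_algebra H : set (G -> R[i]) :=
  [set f | (forall h g k, H h -> H k -> f (h * g * k)%g = f g) /\
           finite_set [set dcoset H g | g in [set g | f g != 0]]].

(* In the definitions below T is meant to be a system of representatives of
   H \ G, and the sums over H \ G are sums over T. *)

Definition l2norm T xi : \bar R :=
  sqrte (\esum_(g in T) (normc (xi g) ^+ 2)%:E).

Definition ell2 H T : set (G -> R[i]) :=
  [set xi | (forall h g, H h -> xi (h * g)%g = xi g) /\
            (l2norm T xi < +oo)%E].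

(* Only finitely many terms are nonzero when f is in the Hecke algebra of an
   almost normal subgroup, so that the sum [\sum_(_ \in _)] over finite
   supports is the actual sum. *)
Definition lambda T f xi : G -> R[i] :=
  fun g => \sum_(h \in T) f (g * h^-1)%g * xi h.

Definition lambda_opnorm H T f : \bar R :=
  ereal_sup [set l2norm T (lambda T f xi) |
             xi in [set xi | ell2 H T xi /\ (l2norm T xi <= 1)%E]].

Definition sobolev_norm T L s f : \bar R :=
  sqrte (\esum_(g in T) (normc (f g) ^+ 2 * (1 + L g) `^ (2 * s))%:E).

(* The inequality is required for every T. If L vanishes on H, neither side
   depends on T. If L is only bounded on H, as it is on K when it vanishes on
   g K g^-1, changing T changes the right-hand side by at most a constant
   factor independent of f, so that the property does not depend on T. *)
Definition property_RD H L : Prop :=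
  exists C s : R, [/\ 0 < C, 0 < s &
    forall f, hecke_algebra H f ->
    forall T, right_transversal H T ->
      (lambda_opnorm H T f <= C%:E * sobolev_norm T L s f)%E].

End RapidDecay.

(* Main.v *)
Require Import Defs.
From mathcomp Require Import all_boot all_order all_algebra.
From mathcomp Require Import all_classical all_reals all_analysis.
From mathcomp Require Import complex lra.

Set Implicit Arguments.
Unset Strict Implicit.
Unset Printing Implicit Defensive.

Import Order.TTheory GRing.Theory Num.Theory.

Local Open Scope classical_set_scope.

(* Since |lambda(f) xi| <= lambda(|f|) |xi| pointwise, property (RD) only needs
   to be tested on nonnegative f and xi, and then all sums may be taken in
   [0, +oo].  Conjugation by g distorts L by at most 2 L(g), hence the Sobolev
   weights by a constant factor, so K may be replaced by g K g^-1.  It remains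
   to compare H with a subgroup M of finite index n.  From M to H: an
   H-invariant function is M-invariant, and sums over M \ G are n times sums
   over H \ G.  From H to M: a nonnegative M-bi-invariant f is dominated by the
   H-bi-invariant
     F(x) = sqrt (sum_(s, s' in M \ H) f(s x s'^-1)^2),
   and an M-invariant xi by Xi(x) = sqrt (sum_(s in M \ H) xi(s x)^2).  As L is
   constant on double cosets of H, the norms over H \ G of F and Xi are
   sqrt n and 1 times those over M \ G of f and xi. *)

(** * Systems of representatives *)

Section Cosets.
Local Open Scope group_scope.
Variable G : groupType.
Implicit Types (H M A B S T X : set G) (x y : G).

Lemma subgroup1 H : subgroup H -> H 1.
Proof. by case; rewrite inE. Qed.

Lemma subgroupM H x y : subgroup H -> H x -> H y -> H (x * y).
Proof.
move=> /group_closedM sH Hx Hy.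
by apply: set_mem; apply: sH; exact: mem_set.
Qed.

Lemma subgroupV H x : subgroup H -> H x -> H x^-1.
Proof.
move=> /group_closedV sH Hx.
by apply: set_mem; apply: sH; exact: mem_set.
Qed.

Lemma rcosetE H x y : rcoset H x y <-> H (y * x^-1).
Proof.
split=> [[h Hh <-]|Hyx]; first by rewrite mulgK.
by exists (y * x^-1) => //; rewrite mulgVK.
Qed.

Lemma lcosetE H x y : lcoset H x y <-> H (x^-1 * y).
Proof.
split=> [[h Hh <-]|Hyx]; first by rewrite mulKg.
by exists (x^-1 * y) => //; rewrite mulVKg.
Qed.

(** A relative form of [right_transversal]: taking [setT] for X gives transversals of M \ G, taking
    a group H containing M gives those of M \ H. *)
Definition representatives M X A : Prop :=
  A `<=` X /\ forall x, X x -> exists! t, A t /\ rcoset M x t.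

Lemma right_transversalE H T :
  right_transversal H T <-> representatives H setT T.
Proof. by split=> [tT|[_ tT] x]; [split|exact: tT]. Qed.

(** The map [e] serves to reindex sums and to recover a representative from any point of its
    coset. *)
Lemma representatives_fun M X A : representatives M X A ->
  exists e : G -> G, forall x, X x ->
    [/\ A (e x), M (e x * x^-1) &
        forall t, A t -> M (t * x^-1) -> t = e x].
Proof.
case=> _ rA.
have /choice[e eP] x : exists t, X x -> [/\ A t, M (t * x^-1) &
    forall t', A t' -> M (t' * x^-1) -> t' = t].
  have [Xx|nXx] := pselect (X x); last by exists x.
  have [t [[At /rcosetE xt] tu]] := rA x Xx.
  exists t => _; split=> // t' At' xt'; apply/esym/tu.
  by split=> //; apply/rcosetE.
by exists e.
Qed.

Lemma representatives_uniq M X A x y : subgroup M -> representatives M X A ->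
  A x -> A y -> M (y / x) -> y = x.
Proof.
move=> sM [AX rA] Ax Ay Mxy; have [t [_ tu]] := rA _ (AX _ Ax).
have <- : t = y by apply: tu; split=> //; apply/rcosetE.
have -> // : t = x.
by apply: tu; split=> //; apply/rcosetE; rewrite mulgV; exact: subgroup1.
Qed.

Lemma representativesP M X A :
  A `<=` X -> (forall x, X x -> exists2 t, A t & M (t * x^-1)) ->
  (forall t t', A t -> A t' -> M (t' * t^-1) -> t' = t) -> subgroup M ->
  representatives M X A.
Proof.
move=> AX exA uA sM; split=> // x /exA[t At xt]; exists t; split.
  by split=> //; apply/rcosetE.
move=> t' [At' /rcosetE xt']; apply: uA => //.
have -> : t * t'^-1 = (t * x^-1) * (t' * x^-1)^-1.
  by rewrite invgM invgK mulgA mulgVK.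
by apply: subgroupM => //; exact: subgroupV.
Qed.

(** The point is chosen from the coset as a set, so the choice is the same for all elements of a
    coset. *)
Lemma exists_representatives M X : subgroup M ->
  (forall m x, M m -> X x -> X (m * x)) -> exists A, representatives M X A.
Proof.
move=> sM MX; pose r x := xget 1 (rcoset M x).
have rP x : M (r x * x^-1).
  by apply/rcosetE/(@xgetI _ _ _ x)/rcosetE; rewrite mulgV; exact: subgroup1.
exists (r @` X); apply: representativesP => //.
- by move=> _ [x Xx <-]; rewrite -(mulgVK x (r x)); exact: MX.
- by move=> x Xx; exists (r x); [exists x|].
move=> _ _ [x _ <-] [y _ <-] xy; rewrite /r; congr xget.
have Mxy : M (y * x^-1).
  rewrite -[y * _]mul1g -(mulVg (r y * y^-1)).
  have -> : (r y / y)^-1 * (r y / y) * (y / x)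
     = (r y / y)^-1 * (r y / r x) * (r x / x) by rewrite !mulgA !mulgVK.
  do 2?[apply: subgroupM => //]; exact: subgroupV.
apply/funext => z; apply/propext; rewrite !rcosetE; split=> Mz.
  by rewrite -(mulgVK y z) -mulgA; apply: subgroupM.
have -> : z / y = z / x * (y / x)^-1 by rewrite invgM invgK mulgA mulgVK.
by apply: subgroupM => //; exact: subgroupV.
Qed.

(** Right translation by h permutes the right cosets of M contained in X. *)
Lemma representatives_mulr M X A h : subgroup M ->
  (forall x, X (x * h) <-> X x) -> representatives M X A ->
  representatives M X [set a * h | a in A].
Proof.
move=> sM Xh [AX rA]; apply: representativesP => //.
- by move=> _ [a /AX Xa <-]; apply/Xh.
- move=> x Xx; have /rA[t [[At /rcosetE xt] _]] : X (x / h).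
    by apply/Xh; rewrite mulgVK.
  by exists (t * h); [exists t|rewrite invgM invgK mulgA in xt].
move=> _ _ [a Aa <-] [b Ab <-]; rewrite invgM mulgA mulgK => ab.
by congr (_ * h); exact: (representatives_uniq sM (conj AX rA)).
Qed.

(** [finite_index_in] counts left cosets while S represents right ones. Inversion exchanges the two:
    s is the representative of y^-1 for any y in s^-1 M. *)
Lemma finite_representatives M H S : subgroup M -> finite_index_in M H ->
  representatives M H S -> subgroup H -> finite_set S.
Proof.
move=> sM [MH fMH] rS sH; have [SH _] := rS.
have [e eP] := representatives_fun rS.
apply: sub_finite_set (finite_image (fun X => e (xget 1 X)^-1) fMH) => s Ss.
have Hs := SH _ Ss; exists (lcoset M s^-1).
  by exists s^-1 => //; exact: subgroupV.
set y := xget 1 _.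
have /lcosetE Mys : lcoset M s^-1 y.
  apply: (@xgetI _ _ _ s^-1); apply/lcosetE; rewrite mulVg; exact: subgroup1.
rewrite invgK in Mys.
have Hy : H y.
  by rewrite -(mulKg s y); apply: subgroupM (subgroupV _ _) _ => //; exact: MH.
have [_ _ eu] := eP _ (subgroupV sH Hy); apply/esym/eu => //.
by rewrite invgK.
Qed.
End Cosets.

(** * Sums of nonnegative families in the extended reals *)

Section Esum.
Variable R : realType.
Local Open Scope ring_scope.
Local Open Scope ereal_scope.

Lemma esumZl (I : choiceType) (A : set I) (c : R) (a : I -> \bar R) :
  (0 < c)%R -> (forall i, 0 <= a i) ->
  \esum_(i in A) (c%:E * a i) = c%:E * \esum_(i in A) a i.
Proof.
have le1 (d : R) (b : I -> \bar R) : (0 < d)%R -> (forall i, 0 <= b i) ->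
    \esum_(i in A) (d%:E * b i) <= d%:E * \esum_(i in A) b i.
  move=> d0 b0; apply: ge_ereal_sup => _ [X [fX XA] <-].
  rewrite -ge0_mule_fsumr//; apply: lee_wpmul2l; first by rewrite lee_fin ltW.
  by apply: esum_ge; exists X.
move=> c0 a0; apply/eqP; rewrite eq_le le1//=.
(* The reverse inequality is the bound [le1] for the factor c^-1 and the family c a. *)
rewrite -(@lee_pmul2l _ c^-1%:E) ?lte_fin ?invr_gt0// muleA -EFinM.
rewrite mulVf ?gt_eqF// mul1e.
apply: le_trans (le1 _ _ _ _); rewrite ?invr_gt0//; last first.
  by move=> i; rewrite mule_ge0// lee_fin ltW.
by apply: le_esum => i _; rewrite muleA -EFinM mulVf ?gt_eqF// mul1e.
Qed.

Lemma exchange_esum (I J : choiceType) (A : set I) (B : set J)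
    (a : I -> J -> \bar R) : (forall i j, 0 <= a i j) ->
  \esum_(i in A) \esum_(j in B) a i j = \esum_(j in B) \esum_(i in A) a i j.
Proof.
move=> a0; rewrite !esum_esum//.
apply: (@reindex_esum _ _ _ _ _ (fun k => (k.2, k.1)) (fun k => a k.1 k.2)).
split.
- by move=> [j i] [/= ? ?].
- by move=> [? ?] [? ?] _ _ /= [-> ->].
- by move=> [i j] [/= ? ?]; exists (j, i).
Qed.

Lemma esum_finite (I : choiceType) (A : set I) (a : I -> R) : finite_set A ->
  (forall i, (0 <= a i)%R) ->
  \esum_(i in A) (a i)%:E = (\sum_(i \in A) a i)%:E.
Proof.
by move=> fA a0; rewrite -fsumEFin// esum_fset// => i _; rewrite lee_fin.
Qed.

Lemma esum_cst (I : choiceType) (A : set I) (c : \bar R) : finite_set A ->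
  0 <= c -> \esum_(i in A) c = (\sum_(i \in A) (1 : R)%R)%:E * c.
Proof.
move=> fA c0; rewrite esum_fset// -fsumEFin// ge0_mule_fsuml//.
by apply: eq_fsbigr => i _; rewrite mul1e.
Qed.

(** [\sum_(_ \in _)] is 0 by default on infinite supports; on finite ones both sums reduce to the
    support. *)
Lemma esum_fsupp (I : choiceType) (A : set I) (a : I -> R) :
  (forall i, (0 <= a i)%R) -> finite_set (A `&` [set i | a i != 0%R]) ->
  \esum_(i in A) (a i)%:E = (\sum_(i \in A) a i)%:E.
Proof.
move=> a0 fA; rewrite fsbig_supp/=.
have -> : A `&` a @^-1` [set~ 0%R] = A `&` [set i | a i != 0%R].
  by congr (_ `&` _); apply/seteqP; split=> i /= /eqP.
rewrite -esum_finite// esum_mkcondr; apply: eq_esum => i _.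
by case: ifPn => //; rewrite notin_setE/= => /negP; rewrite negbK => /eqP ->.
Qed.

End Esum.

(** * Sums over spaces of right cosets *)

Section EsumCosets.
Variables (R : realType) (G : groupType).
Local Open Scope ring_scope.
Local Open Scope group_scope.
Implicit Types (H M A B S T X : set G) (a : G -> \bar R).

(** Replacing each element of A by the element of B in its coset is a bijection that preserves the
    values of a. *)
Lemma esum_representatives M X A B a : subgroup M ->
  representatives M X A -> representatives M X B ->
  (forall m x, M m -> a (m * x) = a x) ->
  \esum_(x in A) a x = \esum_(x in B) a x.
Proof.
move=> sM rA rB aM; have [e eP] := representatives_fun rB.
have [f fP] := representatives_fun rA.
have [AX _] := rA; have [BX _] := rB.
rewrite (@reindex_esum _ _ _ A B e); last first.
  split=> [x /AX/eP[]//|x y|y By].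
    rewrite !inE => Ax Ay exy.
    have [_ xx _] := eP _ (AX _ Ax); have [_ yy _] := eP _ (AX _ Ay).
    apply/esym/(representatives_uniq sM rA) => //.
    rewrite -(divgKA (e y)) -{2}exy -invgF.
    by apply: subgroupM => //; exact: subgroupV.
  have [Ay yy _] := fP _ (BX _ By); exists (f y) => //.
  have [_ _ eu] := eP _ (AX _ Ay); apply/esym/eu => //.
  by rewrite -invgF; exact: subgroupV.
apply: eq_esum => x /AX/eP[_ xx _].
by rewrite -(aM (e x / x) x) // mulgVK.
Qed.

(** Each coset H t splits into the cosets M s t. The products s t need not lie in TM, so the
    reindexing sends (t, s) to the representative of s t. *)
Lemma esum_representatives_refine M H S T TM a : subgroup M -> subgroup H ->
  M `<=` H -> representatives M H S -> representatives H setT T ->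
  representatives M setT TM ->
  (forall x, 0 <= a x)%E -> (forall m x, M m -> a (m * x) = a x) ->
  (\esum_(x in TM) a x = \esum_(t in T) \esum_(s in S) a (s * t)%g)%E.
Proof.
move=> sM sH MH rS rT rTM a0 aM; rewrite esum_esum//.
have [e eP] := representatives_fun rTM.
have [d dP] := representatives_fun rT.
have [c cP] := representatives_fun rS.
have [SH _] := rS.
rewrite (@reindex_esum _ _ _ (T `*`` (fun=> S)) TM (fun k => e (k.2 * k.1))).
- apply: eq_esum => -[t s] _ /=; have [_ ? _] := eP (s * t) I.
  by rewrite -(aM (e (s * t) / (s * t)) (s * t)) // mulgVK.
split=> [[t s] [/= Tt Ss]|[t s] [t' s']|y TMy].
- by have [] := eP (s * t) I.
- rewrite !inE /= => -[/= Tt Ss] [/= Tt' Ss'] ee.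
  have Mst : M (s * t / (s' * t')).
    have [_ m1 _] := eP (s * t) I; have [_ m2 _] := eP (s' * t') I.
    rewrite -(divgKA (e (s * t))) {2}ee -invgF.
    by apply: subgroupM => //; exact: subgroupV.
  (* As M is contained in H, s t and s' t' lie in one right coset of H, which forces t = t';
     cancelling t then identifies s and s'. *)
  have tt' : t = t'.
    apply: (representatives_uniq sH rT) => //.
    have -> : t / t' = s^-1 * (s * t / (s' * t') * s').
      by rewrite invgM !mulgA mulgVK mulVg mul1g.
    apply: (subgroupM sH); first exact: subgroupV sH (SH _ Ss).
    by apply: (subgroupM sH); [exact: MH|exact: SH].
  rewrite -tt' in Mst *; congr (_, _).
  by apply: (representatives_uniq sM rS) => //; rewrite -(mulgKA t).
have [Tt ty _] := dP y I.
set t := d y in Tt ty; have yt : H (y / t) by rewrite -invgF; exact: subgroupV.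
have [Ss sy _] := cP _ yt; exists (t, c (y / t)); first by [].
have [_ _ eu] := eP (c (y / t) * t) I; apply/esym/eu => //=.
by rewrite -invgF; apply: subgroupV => //; rewrite -mulgA -[t / y]invgF.
Qed.

End EsumCosets.

(** The conditions of [hecke_algebra] with values in any [nmodType], so as to cover real and complex
    functions alike. *)
Definition hecke_function (G : groupType) (V : nmodType) (H : set G)
    (f : G -> V) : Prop :=
  (forall h x k, H h -> H k -> f (h * x * k)%g = f x) /\
  finite_set [set dcoset H x | x in [set x | f x != 0%R]].

(** * Supports of Hecke functions *)

Section HeckeSupport.
Variables (G : groupType) (V : nmodType).
Local Open Scope ring_scope.
Implicit Types (H M S T : set G) (f : G -> V).

Local Open Scope group_scope.

Lemma dcosetP H x y :
  dcoset H x y <-> exists h k, [/\ H h, H k & h * x * k = y].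
Proof.
split=> [[h Hh [k Hk <-]]|[h [k [Hh Hk <-]]]]; first by exists h, k.
by exists h => //; exists k.
Qed.

Lemma dcoset_refl H x : subgroup H -> dcoset H x x.
Proof.
move=> /subgroup1 H1; apply/dcosetP.
by exists 1, 1; rewrite mul1g mulg1.
Qed.

Lemma dcoset_eq H x y : subgroup H -> dcoset H x y -> dcoset H x = dcoset H y.
Proof.
move=> sH /dcosetP[h [k [Hh Hk <-]]].
have sub h' k' z : H h' -> H k' -> dcoset H (h' * z * k') `<=` dcoset H z.
  move=> Hh' Hk' _ /dcosetP[a [b [Ha Hb <-]]]; apply/dcosetP.
  exists (a * h'), (k' * b); split; last by rewrite !mulgA.
  - exact: subgroupM.
  - exact: subgroupM.
apply/seteqP; split; last exact: sub.
rewrite -{1}(mulKg h x) -{1}(mulgK k (h * x)) mulgA.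
by apply: sub; exact: subgroupV.
Qed.

(** Sending D to H D H maps the finitely many double cosets of M that meet the support of f onto a
    set containing every double coset of H that meets the support of F. *)
Lemma finite_dcosets_grow (W : nmodType) M H S f (F : G -> W) :
  subgroup M -> subgroup H -> M `<=` H -> S `<=` H ->
  finite_set [set dcoset M x | x in [set x | f x != 0%R]] ->
  (forall x, F x != 0%R ->
    exists2 s, S s & exists2 s', S s' & f (s * x / s') != 0%R) ->
  finite_set [set dcoset H x | x in [set x | F x != 0%R]].
Proof.
move=> sM sH MH SH fin Ff.
apply: sub_finite_set (finite_image (fun D => dcoset H (xget 1 D)) fin).
move=> _ [x /= /Ff[s Ss [s' Ss' fx]] <-]; exists (dcoset M (s * x / s')).
  by exists (s * x / s').
have /dcosetP[m [m' [Mm Mm' <-]]] :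
    dcoset M (s * x / s') (xget 1 (dcoset M (s * x / s'))).
  by apply: (@xgetI _ _ _ (s * x / s')); exact: dcoset_refl.
apply/esym/dcoset_eq => //; apply/dcosetP.
exists (m * s), (s'^-1 * m'); split; last by rewrite !mulgA.
  by apply: subgroupM => //; [exact: MH|exact: SH].
by apply: subgroupM => //; [apply: subgroupV => //; exact: SH|exact: MH].
Qed.

(** H y H is the union of the double cosets M s y s'^-1 M with s and s' in the finite set S. *)
Lemma hecke_function_subgroup M H S f : subgroup M -> subgroup H -> M `<=` H ->
  representatives M H S -> finite_set S ->
  hecke_function H f -> hecke_function M f.
Proof.
move=> sM sH MH rS fS [fH fin]; split.
  by move=> h x k /MH Hh /MH Hk; exact: fH.
have [e eP] := representatives_fun rS.
apply: sub_finite_set (finite_image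
  (fun p => dcoset M (p.1.1 * xget 1 p.2 / p.1.2))
  (finite_setX (finite_setX fS fS) fin)) => _ [x /= fx <-].
have : dcoset H x (xget 1 (dcoset H x)).
  by apply: (@xgetI _ _ _ x); exact: dcoset_refl.
set y := xget 1 _ => /dcosetP[h [k [Hh Hk hxk]]].
have [S1 m1 _] := eP _ (subgroupV sH Hh); have [S2 m2 _] := eP _ Hk.
exists ((e h^-1, e k), dcoset H x); first by split=> //; exists x.
rewrite /= -/y -hxk; apply/esym/dcoset_eq => //; apply/dcosetP.
exists (e h^-1 / h^-1), (k / e k); split=> //.
  by rewrite -invgF; exact: subgroupV.
by rewrite invgK !mulgA.
Qed.

Lemma hecke_function_comp (W : nmodType) (phi : V -> W) H f :
  phi 0%R = 0%R -> hecke_function H f -> hecke_function H (phi \o f).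
Proof.
move=> phi0 [fH fin]; split=> [h x k Hh Hk /=|]; first by rewrite fH.
apply: sub_finite_set fin => _ [x /= fx <-]; exists x => //=.
by apply: contraNneq fx => ->; rewrite phi0.
Qed.

(** If f(y h^-1) is nonzero, y h^-1 lies in one of finitely many double cosets, hence by almost
    normality in one of finitely many left cosets a H; then h is the representative of a^-1 y. *)
Lemma finite_convolution_support H T f y : almost_normal H ->
  right_transversal H T -> hecke_function H f ->
  finite_set (T `&` [set h | f (y / h) != 0%R]).
Proof.
move=> [sH anH] /right_transversalE/representatives_fun[e eP] [_ fin].
have /choice[A AP] x : exists A : set G, finite_set A /\
    dcoset H x = \bigcup_(a in A) lcoset H a.
  by have [A fA AE] := anH x; exists A.
have := bigcup_finite fin (fun D _ => proj1 (AP (xget 1 D))).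
move=> /(finite_image (fun a => e (a^-1 * y))); apply: sub_finite_set.
move=> h [Th /= fh].
set D := dcoset H (y / h); have Dy : D (xget 1 D).
  by apply: (@xgetI _ _ _ (y / h)); exact: dcoset_refl.
have : D (y / h) by exact: dcoset_refl.
rewrite {1}/D (dcoset_eq sH Dy) (proj2 (AP _)) => -[a Aa /lcosetE Hay].
exists a; first by exists D => //; exists (y / h).
have [_ _ eu] := eP (a^-1 * y) I; apply/esym/eu => //.
by rewrite -[_ / _]invgK invgF -mulgA; exact: subgroupV.
Qed.

End HeckeSupport.

(** * Property (RD) for nonnegative functions *)

Section PositiveRD.
Variables (R : realType) (G : groupType).
Local Open Scope group_scope.
Local Open Scope ring_scope.
Implicit Types (H M S T : set G) (L f b xi : G -> R) (s : R).

Definition left_invariant H b := forall h x, H h -> b (h * x)%g = b x.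

(** The value of [lambda] for nonnegative functions, taken in [0, +oo] so that it makes sense
    without a condition on supports. *)
Definition convolution T f xi x : \bar R :=
  \esum_(h in T) (f (x / h)%g * xi h)%:E.

Definition sobolev_sum T L s f : \bar R :=
  \esum_(x in T) (f x ^+ 2 * (1 + L x) `^ (2 * s))%:E.

(** Both sides of the inequality are squared, so this constant corresponds to the square of the one
    in [property_RD]. *)
Definition positive_RD H L : Prop :=
  exists C s : R, [/\ 0 < C, 0 < s &
    forall f, (forall x, 0 <= f x) -> hecke_function H f ->
    forall T, right_transversal H T ->
    forall xi, (forall x, 0 <= xi x) -> left_invariant H xi ->
      (\esum_(x in T) (xi x ^+ 2)%:E <= 1 ->
       \esum_(x in T) convolution T f xi x ^+ 2 <=
         C%:E * sobolev_sum T L s f)%E].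

Lemma convolution_ge0 T f xi x : (forall x, 0 <= f x) ->
  (forall x, 0 <= xi x) -> (0 <= convolution T f xi x)%E.
Proof. by move=> f0 xi0; apply: esum_ge0 => h _; rewrite lee_fin mulr_ge0. Qed.

Lemma sobolev_sum_ge0 T L s f : (0 <= sobolev_sum T L s f)%E.
Proof.
by apply: esum_ge0 => h _; rewrite lee_fin mulr_ge0 ?sqr_ge0 ?powR_ge0.
Qed.

Lemma convolution_left_invariant H T f xi h x : subgroup H ->
  hecke_function H f -> H h ->
  convolution T f xi (h * x)%g = convolution T f xi x.
Proof.
move=> sH [fH _] Hh; apply: eq_esum => y _.
by rewrite -mulgA -[(h * (x / y))%g]mulg1 fH//; exact: subgroup1.
Qed.

(** Subadditivity is applied to h x and to x = h^-1 (h x). *)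
Lemma length_left_invariant H L : length_function L -> H `<=` zero_set L ->
  left_invariant H L.
Proof.
move=> [_ _ LV LM] H0 h x /H0 Lh; apply/eqP; rewrite eq_le.
have {1}-> : L (h * x)%g <= L x by rewrite (le_trans (LM _ _))// Lh add0r.
by rewrite -{1}(mulKg h x) (le_trans (LM _ _))// LV Lh add0r.
Qed.

Lemma length_right_invariant H L : length_function L -> H `<=` zero_set L ->
  subgroup H -> forall x h, H h -> L (x * h)%g = L x.
Proof.
move=> hL H0 sH x h Hh; have [_ _ LV _] := hL.
rewrite -LV invgM (length_left_invariant hL H0) ?LV//; exact: subgroupV.
Qed.

Definition root_sum_squares S b x := Num.sqrt (\sum_(s \in S) b (s * x)%g ^+ 2).

Lemma root_sum_squares_ge0 S b x : 0 <= root_sum_squares S b x.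
Proof. exact: sqrtr_ge0. Qed.

Lemma sqr_root_sum_squares S b x : finite_set S ->
  (root_sum_squares S b x ^+ 2)%:E = \esum_(s in S) (b (s * x)%g ^+ 2)%:E.
Proof.
move=> fS; rewrite sqr_sqrtr; last first.
  by rewrite fsbig_finite//= sumr_ge0// => s _; exact: sqr_ge0.
by rewrite esum_finite// => s; exact: sqr_ge0.
Qed.

(** Evaluating at h x replaces S by S h, another system of representatives of M \ H, and the sum of
    an M-invariant function does not depend on this choice. *)
Lemma root_sum_squares_invariant M H S b : subgroup M -> subgroup H ->
  representatives M H S -> finite_set S -> left_invariant M b ->
  left_invariant H (root_sum_squares S b).
Proof.
move=> sM sH rS fS bM h x Hh; rewrite /root_sum_squares; congr Num.sqrt.
apply: EFin_inj; rewrite -!esum_finite//; try by move=> s; exact: sqr_ge0.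
have rSh : representatives M H [set t * h | t in S]%g.
  apply: representatives_mulr => // y; split=> Hy; last exact: subgroupM.
  by rewrite -(mulgK h y); apply: subgroupM => //; exact: subgroupV.
rewrite (esum_representatives (a := fun y => (b (y * x)%g ^+ 2)%:E) sM rS rSh).
  rewrite esum_image; first by apply: eq_esum => s _; rewrite mulgA.
  by move=> s t _ _ /mulIg.
by move=> m y Mm; rewrite /= -mulgA (bM m).
Qed.

(** The representative of the trivial coset M already contributes the term b(x)^2. *)
Lemma le_root_sum_squares M H S b x : subgroup M -> subgroup H ->
  representatives M H S -> finite_set S -> left_invariant M b ->
  (forall x, 0 <= b x) -> b x <= root_sum_squares S b x.
Proof.
move=> sM sH rS fS bM b0; have [e eP] := representatives_fun rS.
have [Se me _] := eP 1%g (subgroup1 sH); rewrite divg1 in me.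
rewrite -ler_sqr ?nnegrE ?root_sum_squares_ge0//.
rewrite -lee_fin sqr_root_sum_squares//.
apply: esum_ge; exists [set e 1%g]; first by split=> // _ ->.
by rewrite fsbig_set1 bM.
Qed.

End PositiveRD.

(** * Passage between complex and nonnegative functions *)

Section Complexification.
Variables (R : realType) (G : groupType).
Import Normc.
Local Open Scope group_scope.
Local Open Scope ring_scope.
Local Open Scope complex_scope.
Implicit Types (H M S T : set G) (L f b xi : G -> R) (s : R).

Lemma normc_real (x : R) : normc x%:C = `|x|.
Proof. by rewrite /= expr0n addr0 sqrtr_sqr. Qed.

Lemma fsum_complex (I : choiceType) (A : set I) (a : I -> R) :
  finite_set (A `&` [set i | a i != 0]) ->
  \sum_(i \in A) (a i)%:C = (\sum_(i \in A) a i)%:C.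
Proof.
move=> fA.
have sub : A `&` [set i | a i != 0] `<=` A by move=> i [].
rewrite -!(@fsbig_widen _ _ _ _ _ A _ sub).
- by rewrite !fsbig_finite//= rmorph_sum.
- by move=> i [Ai /not_andP[//|/negP]]; rewrite negbK => /eqP.
- by move=> i [Ai /not_andP[//|/negP]]; rewrite negbK /= => /eqP ->.
Qed.

Lemma le_normc_fsum (I : choiceType) (A : set I) (c : I -> R[i]) :
  ((normc (\sum_(i \in A) c i))%:E <= \esum_(i in A) (normc (c i))%:E)%E.
Proof.
have nc0 z : 0 <= normc z :> R by case: z => ? ?; exact: sqrtr_ge0.
have [fA|infA] := pselect (finite_set (A `&` [set i | c i != 0])); last first.
  (* For infinite support the sum on the left is 0 by convention. *)
  rewrite fsbig_dflt ?normc0; last first.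
    apply: contra_not infA; apply: sub_finite_set => i [Ai /= /eqP ci].
    by split=> //=; apply/eqP.
  by apply: esum_ge0 => i _; rewrite lee_fin.
have sub : A `&` [set i | c i != 0] `<=` A by move=> i [].
apply: esum_ge; exists (A `&` [set i | c i != 0]) => //.
rewrite fsumEFin// lee_fin.
rewrite -(@fsbig_widen _ _ _ _ _ A _ sub); last first.
  by move=> i [Ai /not_andP[//|/negP]]; rewrite negbK => /eqP.
rewrite !fsbig_finite//.
elim/big_ind2 : _ => [|x1 x2 y1 y2 h1 h2|//]; first by rewrite normc0.
exact: le_trans (le_normcD _ _) (lerD _ _).
Qed.

Lemma sqrte1 : (sqrte 1 = 1 :> \bar R)%E.
Proof. by rewrite /= sqrtr1. Qed.

(** Almost normality makes the sums in [lambda] finite, so that on nonnegative functions it agrees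
    with [convolution]. *)
Lemma property_RD_positive H L : almost_normal H ->
  property_RD H L -> positive_RD H L.
Proof.
move=> anH [C [s [C0 s0 RD]]]; exists (C ^+ 2), s.
split=> //; first by rewrite exprn_gt0.
move=> f f0 hf T tT xi xi0 xiH xi1.
have hfC : hecke_algebra H (fun x => (f x)%:C).
  by have [] := hecke_function_comp (phi := real_complex R) (rmorph0 _) hf.
have := RD _ hfC T tT.
have l2E b : (forall x, 0 <= b x) -> l2norm T (fun x => (b x)%:C) =
    sqrte (\esum_(x in T) (b x ^+ 2)%:E).
  move=> b0; congr sqrte; apply: eq_esum => x _.
  by rewrite normc_real ger0_norm.
have lamE x : (normc (lambda T (fun x => (f x)%:C) (fun x => (xi x)%:C) x))%:E
    = convolution T f xi x.
  have fin : finite_set (T `&` [set h | f (x / h)%g * xi h != 0]).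
    apply: sub_finite_set (finite_convolution_support x anH tT hf).
    move=> h [Th /= fxi]; split=> //=; apply: contraNneq fxi => ->.
    by rewrite mul0r.
  have := convolution_ge0 T x f0 xi0.
  rewrite /convolution esum_fsupp ?lee_fin//; last by move=> h; exact: mulr_ge0.
  move=> sum0.
  rewrite /lambda; under eq_fsbigr do rewrite -rmorphM.
  by rewrite fsum_complex// normc_real ger0_norm.
move=> RDf.
have le : (l2norm T (lambda T (fun x => (f x)%:C) (fun x => (xi x)%:C)) <=
    C%:E * sobolev_norm T L s (fun x => (f x)%:C))%E.
  apply: le_trans RDf; apply: ereal_sup_ubound.
  exists (fun x => (xi x)%:C) => //; split; last first.
    by rewrite l2E// -[1%E]sqrte1 lee_sqrt.
  split; first by move=> h x Hh; rewrite xiH.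
  by rewrite l2E// (@le_lt_trans _ _ 1%E) ?ltry// -[1%E]sqrte1 lee_sqrt.
have e1 : l2norm T (lambda T (fun x => (f x)%:C) (fun x => (xi x)%:C)) =
    sqrte (\esum_(x in T) convolution T f xi x ^+ 2)%E.
  by congr sqrte; apply: eq_esum => x _; rewrite EFin_expe lamE.
have e2 : sobolev_norm T L s (fun x => (f x)%:C) = sqrte (sobolev_sum T L s f).
  by congr sqrte; apply: eq_esum => x _; rewrite normc_real ger0_norm.
rewrite e1 e2 in le.
have conv0 : (0 <= \esum_(x in T) convolution T f xi x ^+ 2)%E.
  by apply: esum_ge0 => x _; rewrite expe_ge0// convolution_ge0.
have C2 : (C ^+ 2)%:E = (C%:E * C%:E)%E by rewrite EFin_expe.
rewrite -(sqr_sqrte conv0) -(sqr_sqrte (sobolev_sum_ge0 T L s f)).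
rewrite C2 !expe2 muleACA lee_pmul ?sqrte_ge0//.
Qed.

(** Pointwise, |lambda(f) xi| is at most the convolution of |f| and |xi|, and absolute values leave
    the norms of f and xi unchanged. *)
Lemma positive_RD_property H L : positive_RD H L -> property_RD H L.
Proof.
move=> [C [s [C0 s0 RD]]]; exists (Num.sqrt C), s; split=> //.
  by rewrite sqrtr_gt0.
move=> f hf T tT; apply: ge_ereal_sup => _ [xi [[xiH _] xi1] <-].
have nc0 (z : R[i]) : 0 <= normc z by case: z => ? ?; exact: sqrtr_ge0.
rewrite /l2norm /sobolev_norm -/(sqrte C%:E) -sqrteM; last first.
  by rewrite lee_fin ltW.
rewrite lee_sqrt; last first.
  apply: mule_ge0; first by rewrite lee_fin ltW.
  by apply: esum_ge0 => x _; rewrite lee_fin mulr_ge0 ?sqr_ge0 ?powR_ge0.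
have hn : hecke_function H (fun x => normc (f x)).
  have [] := hecke_function_comp (phi := @normc R) _ hf => //.
  exact: normc0.
apply: le_trans (RD _ _ hn T tT (fun x => normc (xi x)) _ _ _) => //.
- apply: le_esum => x _; rewrite EFin_expe lee_sqr ?lee_fin//.
    rewrite (le_trans (le_normc_fsum _ _))//.
    by apply: le_esum => h _; rewrite normcM.
  exact: convolution_ge0.
- by move=> h x Hh /=; rewrite xiH.
- by rewrite -lee_sqrt ?lee01// sqrte1.
Qed.

End Complexification.

(** * Subgroups of finite index *)

Section FiniteIndex.
Variables (R : realType) (G : groupType).
Local Open Scope group_scope.
Local Open Scope ring_scope.

Variables (M H S : set G) (L : G -> R).
Hypotheses (sM : subgroup M) (sH : subgroup H) (fMH : finite_index_in M H).
Hypotheses (rS : representatives M H S) (hL : length_function L).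
Hypothesis (LH : H `<=` zero_set L).
Implicit Types (T : set G) (f xi : G -> R).

Let MH : M `<=` H. Proof. by have [] := fMH. Qed.
Let fS : finite_set S. Proof. exact: finite_representatives rS sH. Qed.
(** The index [H : M], as a real number. *)
Local Notation index := (\sum_(s \in S) (1 : R)).

Let index_gt0 : 0 < index.
Proof.
have [e eP] := representatives_fun rS.
have [Se _ _] := eP 1%g (subgroup1 sH).
rewrite -lte_fin -esum_finite//; apply: (@lt_le_trans _ _ 1%E); first by [].
apply: esum_ge; exists [set e 1%g]; first by split=> // _ ->.
by rewrite fsbig_set1.
Qed.

(** Every coset of H splits into [index] cosets of M, on which an H-invariant function takes a
    single value. *)
Lemma esum_finite_index T TM (a : G -> \bar R) :
  representatives H setT T -> representatives M setT TM ->
  (forall x, 0 <= a x)%E -> (forall h x, H h -> a (h * x)%g = a x) ->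
  \esum_(x in TM) a x = (index%:E * \esum_(x in T) a x)%E.
Proof.
move=> rT rTM a0 aH.
rewrite (esum_representatives_refine sM sH MH rS rT rTM)//; last first.
  by move=> m x /MH; exact: aH.
rewrite -esumZl//; apply: eq_esum => t _.
rewrite -esum_cst//; apply: eq_esum => s Ss; apply: aH.
by have [SH _] := rS; exact: SH.
Qed.

Lemma convolution_finite_index T TM f xi x :
  representatives H setT T -> representatives M setT TM ->
  (forall x, 0 <= f x) -> hecke_function H f -> (forall x, 0 <= xi x) ->
  left_invariant H xi ->
  convolution TM f xi x = (index%:E * convolution T f xi x)%E.
Proof.
move=> rT rTM f0 [fH _] xi0 xiH.
rewrite /convolution (esum_finite_index rT rTM)//.
  by move=> y; rewrite lee_fin mulr_ge0.
move=> h y Hh; rewrite xiH// invgM mulgA -[(x / y / h)%g]mul1g mulgA fH//.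
- exact: subgroup1.
- exact: subgroupV.
Qed.

Lemma positive_RD_supergroup : positive_RD M L -> positive_RD H L.
Proof.
move=> [C [s [C0 s0 RD]]]; exists (C / index), s.
split=> //; first by rewrite divr_gt0.
move=> f f0 hf T tT xi xi0 xiH xi1.
have rT := proj1 (right_transversalE _ _) tT.
have [TM rTM] : exists TM, representatives M setT TM.
  exact: exists_representatives.
(* Over M \ G the sum of squares of xi is [index] times that over H \ G; scaling by c restores the
   norm. *)
pose c := (Num.sqrt index)^-1.
have c0 : 0 < c by rewrite invr_gt0 sqrtr_gt0.
have c2 : c ^+ 2 = index^-1 by rewrite exprVn sqr_sqrtr// ltW.
pose xiM x := c * xi x.
have convE x : (convolution TM f xiM x ^+ 2 =
    index%:E * convolution T f xi x ^+ 2)%E.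
  have -> : convolution TM f xiM x = (c%:E * convolution TM f xi x)%E.
    rewrite /convolution -esumZl//; last by move=> h; rewrite lee_fin mulr_ge0.
    by apply: eq_esum => h _; rewrite -EFinM mulrCA.
  rewrite (convolution_finite_index _ rT rTM)// muleA -EFinM !expe2 muleACA.
  congr (_ * _)%E; rewrite -EFinM -expr2 exprMn c2 expr2 mulrA mulVf ?mul1r//.
  exact: lt0r_neq0.
have sq0 x : (0 <= convolution T f xi x ^+ 2)%E.
  by rewrite expe_ge0// convolution_ge0.
have xiME : \esum_(x in TM) (xiM x ^+ 2)%:E = \esum_(x in T) (xi x ^+ 2)%:E.
  rewrite (esum_finite_index rT rTM).
  - rewrite -esumZl//; last by move=> x; rewrite lee_fin sqr_ge0.
    apply: eq_esum => x _.
    by rewrite -EFinM exprMn c2 mulrA divff ?mul1r// gt_eqF.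
  - by move=> x; rewrite lee_fin sqr_ge0.
  - by move=> h x Hh; rewrite /xiM xiH.
have convME : (\esum_(x in TM) convolution TM f xiM x ^+ 2 =
    index%:E * (index%:E * \esum_(x in T) convolution T f xi x ^+ 2))%E.
  rewrite -esumZl// -(esum_finite_index rT rTM)//.
  - by apply: eq_esum => x _; exact: convE.
  - by move=> x; rewrite mule_ge0// lee_fin ltW.
  - by move=> h x Hh; rewrite (convolution_left_invariant _ _ _ sH hf).
have sobE : sobolev_sum TM L s f = (index%:E * sobolev_sum T L s f)%E.
  rewrite /sobolev_sum (esum_finite_index rT rTM)//.
    by move=> x; rewrite lee_fin mulr_ge0 ?sqr_ge0 ?powR_ge0.
  move=> h x Hh; have [fH _] := hf.
  rewrite (length_left_invariant hL LH)// -[(h * x)%g]mulg1 fH//.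
  exact: subgroup1.
have := RD f f0 (hecke_function_subgroup sM sH MH rS fS hf) TM
  (proj2 (right_transversalE _ _) rTM) xiM.
rewrite xiME convME sobE => RDM.
have {}RDM := RDM (fun x => mulr_ge0 (ltW c0) (xi0 x)) _ xi1.
(* Over M \ G the left side acquires index^2 and the Sobolev sum one factor [index], whence the
   constant C / index. *)
rewrite -(@lee_pmul2l _ (index * index)%:E) ?lte_fin ?mulr_gt0//.
have -> : ((index * index)%:E * ((C / index)%:E * sobolev_sum T L s f) =
    C%:E * (index%:E * sobolev_sum T L s f))%E.
  rewrite !muleA -!EFinM mulrACA divff ?gt_eqF//.
  by rewrite mulr1 (mulrC index).
rewrite EFinM -muleA; apply: RDM => h x Hh.
by rewrite /xiM xiH//; exact: MH.
Qed.

Lemma positive_RD_subgroup : positive_RD H L -> positive_RD M L.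
Proof.
(* Two factors [index] come from the squared convolution, one from the outer sum over M \ G, one
   from the Sobolev sum of F. *)
move=> [C [s [C0 s0 RD]]]; exists (C * index ^+ 4), s.
split=> //; first by rewrite mulr_gt0 ?exprn_gt0.
move=> f f0 hf TM tTM xi xi0 xiM xi1; have [fM fin] := hf.
have rTM := proj1 (right_transversalE _ _) tTM.
have [T rT] : exists T, representatives H setT T.
  exact: exists_representatives.
have [SH _] := rS.
(* Inversion moves the construction to the right: f1(x)^2 is the sum of the f(x u^-1)^2, and f1 is
   right H-invariant. F then adds invariance on the left. *)
pose f1 x := root_sum_squares S (fun y => f y^-1%g) x^-1%g.
pose F := root_sum_squares S f1.
pose Xi := root_sum_squares S xi.
have M1 := subgroup1 sM.
have f1E x : (f1 x ^+ 2)%:E = \esum_(s in S) (f (x / s)%g ^+ 2)%:E.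
  rewrite sqr_root_sum_squares//; apply: eq_esum => u _.
  by rewrite invgM invgK.
have f10 x : 0 <= f1 x by exact: root_sum_squares_ge0.
have f1M : left_invariant M f1.
  move=> m x Mm; rewrite /f1 /root_sum_squares; congr Num.sqrt.
  apply: eq_fsbigr => u _; rewrite !invgM !invgK -mulgA.
  by rewrite -[(m * _)%g]mulg1 fM.
have finvM : left_invariant M (fun y => f y^-1%g).
  move=> m x Mm; rewrite invgM -[(x^-1 * _)%g]mul1g mulgA fM//.
  exact: subgroupV.
have f1H x h : H h -> f1 (x * h)%g = f1 x.
  move=> Hh; rewrite /f1 invgM.
  rewrite (root_sum_squares_invariant sM sH rS fS finvM)//.
  exact: subgroupV.
have FH : left_invariant H F by exact: root_sum_squares_invariant f1M.
have hF : hecke_function H F.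
  split=> [h x k Hh Hk|].
    rewrite -mulgA FH// /F /root_sum_squares; congr Num.sqrt.
    by apply: eq_fsbigr => u _; rewrite mulgA f1H.
  apply: finite_dcosets_grow sM sH MH SH fin _ => x Fx.
  have [u Su f1u] : exists2 u, S u & f1 (u * x)%g != 0.
    apply: contrapT => nex; move/eqP: Fx; apply.
    rewrite /F /root_sum_squares fsbig1 ?sqrtr0// => u Su.
    have [->|] := eqVneq (f1 (u * x)%g) 0; first by rewrite expr0n.
    by move=> ?; case: nex; exists u.
  exists u => //; apply: contrapT => nex; move/eqP: f1u; apply.
  rewrite /f1 /root_sum_squares fsbig1 ?sqrtr0// => v Sv.
  rewrite invgM invgK; have [->|] := eqVneq (f (u * x / v)%g) 0.
    by rewrite expr0n.
  by move=> ?; case: nex; exists v.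
have f1_ge x : f x <= f1 x.
  have := le_root_sum_squares x^-1%g sM sH rS fS finvM (fun=> f0 _).
  by rewrite invgK.
have F_ge x : f x <= F x.
  exact: le_trans (f1_ge x) (le_root_sum_squares _ sM sH rS fS f1M f10).
have Xi_ge x : xi x <= Xi x by exact: le_root_sum_squares sM sH rS fS xiM xi0.
have Xi0 x : 0 <= Xi x by exact: root_sum_squares_ge0.
have F0 x : 0 <= F x by exact: root_sum_squares_ge0.
have XiH : left_invariant H Xi by exact: root_sum_squares_invariant xiM.
have XiE : \esum_(x in T) (Xi x ^+ 2)%:E = \esum_(x in TM) (xi x ^+ 2)%:E.
  rewrite (esum_representatives_refine sM sH MH rS rT rTM).
  - by apply: eq_esum => t _; rewrite sqr_root_sum_squares.
  - by move=> x; rewrite lee_fin sqr_ge0.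
  - by move=> m x Mm; rewrite xiM.
have sobE : sobolev_sum T L s F = (index%:E * sobolev_sum TM L s f)%E.
  (* The weight is H-invariant on both sides, so it passes under both sums of squares. *)
  pose w x := (1 + L x) `^ (2 * s).
  have w_gt0 x : 0 < w x.
    by have [L0 _ _ _] := hL; rewrite powR_gt0// ltr_pwDl.
  have w0 x : 0 <= w x by exact: ltW.
  have wl h x : H h -> w (h * x)%g = w x.
    by move=> Hh; rewrite /w (length_left_invariant hL LH).
  have wr x h : H h -> w (x * h)%g = w x.
    by move=> Hh; rewrite /w (length_right_invariant hL LH sH).
  transitivity (\esum_(x in TM) (f1 x ^+ 2 * w x)%:E).
    rewrite (esum_representatives_refine sM sH MH rS rT rTM).
    - apply: eq_esum => t _; rewrite EFinM muleC sqr_root_sum_squares//.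
      rewrite -(esumZl _ (w_gt0 t)); last by move=> u; rewrite lee_fin sqr_ge0.
      by apply: eq_esum => u Su; rewrite -EFinM mulrC wl//; exact: SH.
    - by move=> x; rewrite lee_fin mulr_ge0 ?sqr_ge0.
    - by move=> m x Mm; rewrite f1M// wl//; exact: MH.
  transitivity (\esum_(x in TM) \esum_(u in S)
      (f (x / u)%g ^+ 2 * w (x / u)%g)%:E).
    apply: eq_esum => x _; rewrite EFinM muleC f1E.
    rewrite -(esumZl _ (w_gt0 x)); last by move=> u; rewrite lee_fin sqr_ge0.
    apply: eq_esum => u Su; rewrite -EFinM mulrC wr//.
    by apply: subgroupV => //; exact: SH.
  (* For fixed u, translation by u^-1 yields another transversal of M \ G, so each of the [index]
     values of u contributes the Sobolev sum of f. *)
  rewrite exchange_esum; last by move=> x u; rewrite lee_fin mulr_ge0 ?sqr_ge0.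
  rewrite -[RHS](esum_cst fS (sobolev_sum_ge0 TM L s f)).
  apply: eq_esum => u Su.
  pose a x := (f x ^+ 2 * w x)%:E.
  have rTMu : representatives M setT [set x * u^-1 | x in TM]%g.
    exact: representatives_mulr.
  rewrite /sobolev_sum -/(w _) (esum_representatives (a := a) sM rTM rTMu).
    by rewrite esum_image// => x y _ _ /mulIg.
  move=> m x Mm; rewrite /a wl; last exact: MH.
  by rewrite -[(m * x)%g]mulg1 fM.
have RDH := RD F F0 hF T (proj2 (right_transversalE _ _) rT) Xi Xi0 XiH.
rewrite XiE sobE in RDH; have {RDH}RDH := RDH xi1.
(* After f and xi are replaced by their majorants, the summand is H-invariant and its sum over M \ G
   is [index] times that over H \ G. *)
have conv_le x : (convolution TM f xi x <= index%:E * convolution T F Xi x)%E.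
  rewrite -(convolution_finite_index _ rT rTM)//.
  by apply: le_esum => y _; rewrite lee_fin ler_pM.
have convM2 x : (convolution TM f xi x ^+ 2 <=
    (index ^+ 2)%:E * convolution T F Xi x ^+ 2)%E.
  rewrite EFin_expe !expe2 muleACA lee_pmul ?convolution_ge0//.
apply: le_trans (le_esum (fun x _ => convM2 x)) _.
have sq0 x : (0 <= convolution T F Xi x ^+ 2)%E.
  by rewrite expe_ge0// convolution_ge0.
rewrite esumZl ?exprn_gt0// (esum_finite_index rT rTM)//; last first.
  by move=> h x Hh; rewrite (convolution_left_invariant _ _ _ sH hF).
have -> : ((C * index ^+ 4)%:E * sobolev_sum TM L s f =
    (index ^+ 3)%:E * (C%:E * (index%:E * sobolev_sum TM L s f)))%E.
  rewrite !muleA -!EFinM; congr (_%:E * _)%E.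
  by rewrite (mulrC (_ ^+ 3)) -mulrA -exprSr.
rewrite muleA -EFinM -exprSr lee_pmul2l ?lte_fin ?exprn_gt0//.
Qed.

End FiniteIndex.

(** * Conjugate subgroups *)

Section Conjugation.
Variables (R : realType) (G : groupType).
Local Open Scope ring_scope.
Local Open Scope group_scope.
Implicit Types (K T : set G) (g x : G).

Lemma conjugateE g K x : conjugate g K x <-> K (x ^ g).
Proof.
split=> [[k Kk <-]|Kx]; first by rewrite conjgE mulgVK mulKg.
by exists (x ^ g) => //; rewrite conjgE mulVKg mulgK.
Qed.

Lemma conjugateK g K : conjugate g^-1 (conjugate g K) = K.
Proof. by apply/seteqP; split=> x; rewrite !conjugateE conjgKV. Qed.

Lemma subgroup_conjugate g K : subgroup K -> subgroup (conjugate g K).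
Proof.
move=> sK; split; first by rewrite inE conjugateE conj1g; exact: subgroup1.
move=> x y; rewrite !inE !conjugateE conjMg conjVg => Kx Ky.
by apply: subgroupM => //; exact: subgroupV.
Qed.

Lemma dcoset_conjugate g K x :
  dcoset K (x ^ g) = [set y ^ g | y in dcoset (conjugate g K) x].
Proof.
apply/seteqP; split=> [_ /dcosetP[h [k [Kh Kk <-]]]|z [y /dcosetP[h [k []]]]].
  exists (h ^ g^-1 * x * k ^ g^-1).
    apply/dcosetP; exists (h ^ g^-1), (k ^ g^-1).
    by split=> //; apply/conjugateE; rewrite conjgKV.
  by rewrite /= (conjMg (_ * x)) (conjMg (h ^ _)) !conjgKV.
move=> /conjugateE Kh /conjugateE Kk <- <-; apply/dcosetP.
by exists (h ^ g), (k ^ g); rewrite !conjMg.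
Qed.

(** [x ^ g^-1] is g x g^-1, so this transports functions from the conjugate back to K. *)
Lemma hecke_function_conjugate (V : nmodType) g K (f : G -> V) :
  hecke_function (conjugate g K) f -> hecke_function K (fun x => f (x ^ g^-1)).
Proof.
move=> [fK fin]; split=> [h x k Kh Kk|].
  by rewrite !conjMg fK//; apply/conjugateE; rewrite conjgKV.
apply: sub_finite_set (finite_image (fun X => [set y ^ g | y in X]) fin).
move=> _ [x /= fx <-]; rewrite -{1}(conjgKV g x) dcoset_conjugate.
by exists (dcoset (conjugate g K) (x ^ g^-1)) => //; exists (x ^ g^-1).
Qed.

Lemma right_transversal_conjugate g K T :
  right_transversal (conjugate g K) T ->
  right_transversal K [set t ^ g | t in T].
Proof.
move=> tT x; have [t [[Tt /rcosetE/conjugateE Kt] tu]] := tT (x ^ g^-1).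
rewrite conjMg conjVg conjgKV in Kt.
exists (t ^ g); split; first by split; [exists t|apply/rcosetE].
move=> _ [[u Tu <-] /rcosetE Ku]; congr (_ ^ g); apply: tu; split=> //.
by apply/rcosetE/conjugateE; rewrite conjMg conjVg conjgKV.
Qed.

(** Conjugation preserves the convolution and the sums of squares; only the Sobolev weights change,
    by at most the factor D. *)
Lemma positive_RD_conjugate g K (L : G -> R) : length_function L ->
  positive_RD K L -> positive_RD (conjugate g K) L.
Proof.
move=> [L0 _ LV LM] [C [s [C0 s0 RD]]].
pose D : R := ((1 + L g + L g) `^ (2 * s))%R.
have Lg0 := L0 g.
have D1_gt0 : (0 < 1 + L g + L g)%R by rewrite -addrA ltr_pwDl ?addr_ge0.
have D0 : (0 < D)%R by rewrite powR_gt0.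
exists (C * D)%R, s; split=> //; first by rewrite mulr_gt0.
move=> f f0 hf T tT xi xi0 xiH xi1.
pose T' := [set t ^ g | t in T].
have inj : set_inj T (conjg^~ g) by move=> x y _ _ /conjg_inj.
have esumE (a : G -> \bar R) : \esum_(x in T') a x = \esum_(t in T) a (t ^ g).
  by rewrite esum_image.
pose f' x := f (x ^ g^-1); pose xi' x := xi (x ^ g^-1).
have convE x : convolution T' f' xi' (x ^ g) = convolution T f xi x.
  rewrite /convolution esumE; apply: eq_esum => h _.
  by rewrite /f' /xi' -conjVg -conjMg !conjgK.
have RDK := RD f' (fun=> f0 _) (hecke_function_conjugate hf) T'
  (right_transversal_conjugate tT) xi' (fun=> xi0 _).
have {RDK} : (\esum_(x in T') convolution T' f' xi' x ^+ 2 <=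
    C%:E * sobolev_sum T' L s f')%E.
  apply: RDK.
    move=> h x Kh; rewrite /xi' conjMg xiH//.
    by apply/conjugateE; rewrite conjgKV.
  by rewrite esumE; under eq_esum do rewrite /xi' conjgK.
rewrite esumE; under eq_esum do rewrite convE.
move=> /le_trans; apply.
rewrite EFinM -muleA lee_pmul2l ?lte_fin//.
rewrite /sobolev_sum esumE -esumZl//; last first.
  by move=> x; rewrite lee_fin mulr_ge0 ?sqr_ge0 ?powR_ge0.
apply: le_esum => t _; rewrite /f' conjgK -EFinM lee_fin mulrCA.
apply: ler_wpM2l; first exact: sqr_ge0.
have L1 x : (0 <= 1 + L x)%R by rewrite addr_ge0.
have Lg1 := ltW D1_gt0.
rewrite /D -powRM//; apply: ge0_ler_powR; rewrite ?nnegrE ?mulr_ge0 ?(ltW s0)//.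
have Lt : (L (t ^ g)%g <= L t + L g + L g)%R.
  rewrite conjgE (le_trans (LM _ _))// LV addrC lerD2r.
  exact: LM.
apply: (@le_trans _ _ (1 + (L t + L g + L g)))%R; first by rewrite lerD2l.
(* The product (1 + 2 L(g)) (1 + L(t)) exceeds the left side by 2 L(g) L(t). *)
have := mulr_ge0 (L0 t) Lg0; lra.
Qed.

End Conjugation.

(** * Comparison of H and K through the intersection of H with g K g^-1 *)

Theorem corollary2p14 (R : realType) (G : groupType) (H K : set G)
    (hH : almost_normal H) (hK : almost_normal K)
    (g : G) (hg : strongly_commensurable (conjugate g K) H)
    (L : G -> R) (hL : length_function L)
    (hN : conjugate g K `|` H `<=` zero_set L) :
  property_RD H L <-> property_RD K L.
Proof.
have [sH sK] := (proj1 hH, proj1 hK).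
set K' := conjugate g K in hg hN.
have sK' : subgroup K' by exact: subgroup_conjugate.
have sM : subgroup (K' `&` H).
  split; first by rewrite inE; split; exact: subgroup1.
  move=> x y; rewrite !inE => -[K'x Hx] [K'y Hy].
  by split; apply: subgroupM => //; exact: subgroupV.
have [fK' fH] := hg.
have LK' : K' `<=` zero_set L by move=> x K'x; apply: hN; left.
have LH : H `<=` zero_set L by move=> x Hx; apply: hN; right.
have [S rS] : exists S, representatives (K' `&` H) K' S.
  by apply: exists_representatives => // m x [K'm _]; exact: subgroupM.
have [S' rS'] : exists S, representatives (K' `&` H) H S.
  by apply: exists_representatives => // m x [_ Hm]; exact: subgroupM.
(* For the converse, g K g^-1 is conjugated back by g^-1. *)
have KK' : positive_RD K L <-> positive_RD K' L.
  split=> [|/(@positive_RD_conjugate _ _ g^-1%g _ _ hL)].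
    exact: positive_RD_conjugate.
  by rewrite conjugateK.
have K'M : positive_RD K' L <-> positive_RD (K' `&` H) L.
  split; first exact: positive_RD_subgroup rS hL LK'.
  exact: positive_RD_supergroup rS hL LK'.
have HM : positive_RD H L <-> positive_RD (K' `&` H) L.
  split; first exact: positive_RD_subgroup rS' hL LH.
  exact: positive_RD_supergroup rS' hL LH.
split=> [/(property_RD_positive hH)|/(property_RD_positive hK)] rd.
  by apply: positive_RD_property; apply/KK'/K'M/HM.
by apply: positive_RD_property; apply/HM/K'M/KK'.
Qed.
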